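(* For any formal power series $P(z)\in\mathbb{C}[[z]]$ (not necessarily HN) with $o(P(z))\ge2$ and $(\mathrm{Hes}\,P)(0)$ nilpotent, we have $$U_t(z)=Q_t+t\,\frac{\partial Q_t}{\partial t},$$ $$V_t(z)=\frac12\sigma_2+t\Big(z\frac{\partial Q_t}{\partial z}-Q_t\Big),$$ $$W_t(z)=\sigma_2+2t\,z\frac{\partial Q_t}{\partial z}+2t^2\,\frac{\partial Q_t}{\partial t}.$$
   Context: $z=(z_1,\dots,z_n)$, $\nabla g=(\partial g/\partial z_1,\dots,\partial g/\partial z_n)$, $\mathrm{Hes}\,P$ is the Hessian matrix of $P$, and $o(P)$ is the smallest total degree of a monomial occurring in $P$. $z\frac{\partial}{\partial z}:=\sum_{i=1}^nz_i\frac{\partial}{\partial z_i}$ and $\sigma_2:=\sum_{i=1}^nz_i^2$. A series is HN if its Hessian matrix is nilpotent. Let $t$ be a formal central parameter and $F_t(z)=z-t\nabla P(z)$. Under the stated hypotheses $F_t$ has a formal inverse $G_t(z)=z+t\nabla Q_t(z)$ under composition, for a unique $Q_t\in\mathbb{C}[t][[z]]$ of order at least $2$ in $z$ (the deformed inversion pair of $P$). Set $f_t(z):=\frac12\sigma_2-tP(z)$ and $$U_t(z):=P(G_t(z)),\qquad V_t(z):=f_t(G_t(z)),\qquad W_t(z):=\sigma_2(G_t(z)).$$ *)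

(* Defs.v *)
From HB Require Import structures.
From mathcomp Require Import all_boot all_order all_algebra.
From mathcomp Require Import reals complex mpoly.

Set Implicit Arguments.
Unset Strict Implicit.
Unset Printing Implicit Defensive.

Import GRing.Theory.
Local Open Scope ring_scope.

(* A[[z_1, ..., z_n]]: a series is its family of coefficients, so equality of
   series is [=1] and addition and scaling are the coefficientwise [\+], [\-]
   and [a \*o f]. *)
Definition fps (n : nat) (A : comNzRingType) := 'X_{1..n} -> A.

Section PowerSeries.
Context (n : nat) (A : comNzRingType).
Implicit Types (f g : fps n A) (i j : 'I_n).

Definition fps_of_mpoly (p : {mpoly A[n]}) : fps n A := fun m => p@_m.

Definition zvar i : fps n A := fps_of_mpoly 'X_i.

Definition sigma2 : fps n A := fps_of_mpoly (\sum_(i < n) 'X_i ^+ 2).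

(* Cauchy product, in the form of [mcoeffM]. *)
Definition fps_mul f g : fps n A := fun m =>
  \sum_(k : 'X_{1..n < (mdeg m).+1, (mdeg m).+1} | m == (k.1 + k.2)%MM)
     f k.1 * g k.2.

Definition fps_trunc (d : nat) f : {mpoly A[n]} :=
  \sum_(m : 'X_{1..n < d}) f m *: 'X_[m].

(* f (g_1, ..., g_n) for series g_i without constant term: the coefficient of
   z^m in the composite only involves the terms of total degree at most |m| of
   f and of the g_i.  Not meaningful if some g_i has a nonzero constant term. *)
Definition fps_comp f (g : 'I_n -> fps n A) : fps n A := fun m =>
  let d := (mdeg m).+1 in
  (fps_trunc d f \mPo [tuple fps_trunc d (g i) | i < n])@_m.

Definition fps_deriv i f : fps n A := fun m =>
  f (m + U_(i))%MM *+ (m i).+1.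

Definition euler f : fps n A := fun m =>
  \sum_(i < n) fps_mul (zvar i) (fps_deriv i f) m.

(* o(f) >= d; it holds for every d when f = 0. *)
Definition order_ge (d : nat) f : Prop :=
  forall m, f m != 0 -> (d <= mdeg m)%N.

Definition Hes f i j : fps n A := fps_deriv i (fps_deriv j f).

Definition Hes0 f : 'M[A]_n := \matrix_(i, j) Hes f i j 0%MM.

Definition mutually_inverse (F G : 'I_n -> fps n A) : Prop :=
  (forall i, fps_comp (F i) G =1 zvar i) /\
  (forall i, fps_comp (G i) F =1 zvar i).

End PowerSeries.

Arguments zvar {n A} i.
Arguments sigma2 {n A}.

Definition nilpotent_mx (n : nat) (A : nzRingType) (M : 'M[A]_n) : Prop :=
  exists k : nat, M ^+ k = 0.

(* C[t] is {poly R[i]}, with t = 'X. *)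
Section DeformedInversion.
Context (R : realType) (n : nat).
Local Notation C := R[i].
Implicit Types (P : fps n C) (Q : fps n {poly C}).

Definition const_t P : fps n {poly C} := fun m => (P m)%:P.

Definition dt Q : fps n {poly C} := fun m => (Q m)^`().

Definition Ft P (i : 'I_n) : fps n {poly C} :=
  zvar i \- 'X \*o fps_deriv i (const_t P).

Definition Gt Q (i : 'I_n) : fps n {poly C} :=
  zvar i \+ 'X \*o fps_deriv i Q.

Definition deformed_inversion_pair P Q : Prop :=
  order_ge 2 Q /\ mutually_inverse (Ft P) (Gt Q).

Definition ft P : fps n {poly C} :=
  (2^-1)%:P \*o sigma2 \- 'X \*o const_t P.

Definition Ut P Q : fps n {poly C} := fps_comp (const_t P) (Gt Q).
Definition Vt P Q : fps n {poly C} := fps_comp (ft P) (Gt Q).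
Definition Wt Q : fps n {poly C} := fps_comp sigma2 (Gt Q).

End DeformedInversion.

(* Main.v *)
(* Write G = z + t grad Q.  From F(G) = z one gets grad Q = (grad P)(G), so
   both the z-derivatives and the t-derivative of U = P(G) are given by the
   chain rule as sum_j d_j Q * D(G_j).  For D = d/dz_i this is the gradient of
   Q + t/2 |grad Q|^2, hence U = Q + t/2 |grad Q|^2; comparing the t-derivatives
   of both sides yields the Hamilton-Jacobi equation dQ/dt = 1/2 |grad Q|^2.
   The formula for U follows, the one for W by expanding the sum of the G_i^2,
   and V = W/2 - t U.  Composition and derivation of series are continuous in the
   z-adic topology, so polynomial truncations of P and Q suffice, with every
   identity holding modulo terms of high degree in z. *)
Require Import Defs.
From HB Require Import structures.
From mathcomp Require Import all_boot all_order all_algebra.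
From mathcomp Require Import reals complex mpoly ring.

Set Implicit Arguments.
Unset Strict Implicit.
Unset Printing Implicit Defensive.

Import GRing.Theory Num.Theory.
Local Open Scope ring_scope.

(** * Congruence of series modulo terms of degree at least [d] *)

Definition agree (n : nat) (A : comNzRingType) (d : nat) (f g : fps n A) :=
  forall m, (mdeg m < d)%N -> f m = g m.

Section Agree.
Context (n : nat) (A : comNzRingType).
Implicit Types (f g h : fps n A) (p q : {mpoly A[n]}).

Lemma agree_sym d f g : agree d f g -> agree d g f.
Proof. by move=> fg m /fg. Qed.

Lemma agree_trans d f g h : agree d f g -> agree d g h -> agree d f h.
Proof. by move=> fg gh m m_d; rewrite fg // gh. Qed.

Lemma agree_le d d' f g : (d <= d')%N -> agree d' f g -> agree d f g.
Proof. by move=> dd' fg m m_d; apply/fg/(leq_trans m_d). Qed.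

End Agree.

Local Notation agreep d p q := (agree d (fps_of_mpoly p) (fps_of_mpoly q)).

Section AgreePoly.
Context (n : nat) (A : comNzRingType).
Implicit Types (p q : {mpoly A[n]}).

Lemma agreepB0 d p q : agreep d (p - q) 0 <-> agreep d p q.
Proof.
split=> pq m /pq; rewrite /fps_of_mpoly mcoeff0 mcoeffB.
  by move/eqP; rewrite subr_eq0 => /eqP.
by move=> ->; rewrite subrr.
Qed.

Lemma agreepD d p p' q q' :
  agreep d p p' -> agreep d q q' -> agreep d (p + q) (p' + q').
Proof.
move=> pp' qq' m m_d; rewrite /fps_of_mpoly !mcoeffD.
exact: congr2 (pp' m m_d) (qq' m m_d).
Qed.

Lemma agreepZ d a p p' : agreep d p p' -> agreep d (a *: p) (a *: p').
Proof. by move=> pp' m m_d; rewrite /fps_of_mpoly !mcoeffZ [p@_m]pp'. Qed.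

Lemma agreep_sum d (I : Type) (r : seq I) (F F' : I -> {mpoly A[n]}) :
    (forall i, agreep d (F i) (F' i)) ->
  agreep d (\sum_(i <- r) F i) (\sum_(i <- r) F' i).
Proof.
move=> FF'; elim/big_ind2: _ => // p p' q q' pp' qq'; exact: agreepD.
Qed.

Lemma agreepM d p p' q q' :
  agreep d p p' -> agreep d q q' -> agreep d (p * q) (p' * q').
Proof.
move=> pp' qq' m m_d; rewrite /fps_of_mpoly !mcoeffM.
apply: eq_bigr => -[k1 k2] /= /eqP m_k.
have m_d' : (mdeg k1 + mdeg k2 < d)%N by rewrite -mdegD -m_k.
congr (_ * _); first exact/pp'/(leq_ltn_trans (leq_addr _ _) m_d').
exact/qq'/(leq_ltn_trans (leq_addl _ _) m_d').
Qed.

Lemma agreepX d k p p' : agreep d p p' -> agreep d (p ^+ k) (p' ^+ k).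
Proof.
by move=> pp'; elim: k => // k IHk; rewrite !exprS; apply: agreepM.
Qed.

Lemma agreep_prod d (I : Type) (r : seq I) (F F' : I -> {mpoly A[n]}) :
    (forall i, agreep d (F i) (F' i)) ->
  agreep d (\prod_(i <- r) F i) (\prod_(i <- r) F' i).
Proof.
move=> FF'; elim/big_ind2: _ => // p p' q q' pp' qq'; exact: agreepM.
Qed.

(** Orders add: if |k1| + |k2| < a + b, then |k1| < a or |k2| < b, so every term of the Cauchy
    product vanishes. *)
Lemma agreepM0 a b p q :
  agreep a p 0 -> agreep b q 0 -> agreep (a + b) (p * q) 0.
Proof.
move=> p0 q0 m m_ab; rewrite /fps_of_mpoly mcoeffM mcoeff0.
apply: big1 => -[k1 k2] /= /eqP m_k.
have [k1a|k1a] := ltnP (mdeg k1) a.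
  by rewrite [p@__](p0 _ k1a) /fps_of_mpoly mcoeff0 mul0r.
rewrite [q@__]q0 /fps_of_mpoly ?mcoeff0 ?mulr0 //.
rewrite -(ltn_add2l a) (leq_ltn_trans _ m_ab) //.
by rewrite [X in (_ <= mdeg X)%N]m_k mdegD leq_add2r.
Qed.

End AgreePoly.

Lemma subUU (n : nat) (i : 'I_n) : (U_(i) - U_(i) = 0 :> 'X_{1..n})%MM.
Proof. by apply/mnmP => j; rewrite mnmBE subnn mnm0E. Qed.

(** * Continuity of composition and the chain rule for polynomials *)

Section Composition.
Context (n k : nat) (A : comNzRingType).
Implicit Types (p q : {mpoly A[n]}) (g h : n.-tuple {mpoly A[k]}).

Lemma prod_order g (m : 'X_{1..n}) :
    (forall i, (tnth g i)@_0 = 0) ->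
  agreep (mdeg m) (\prod_(i < n) tnth g i ^+ m i) 0.
Proof.
move=> g0; rewrite mdegE.
apply: (big_rec2 (fun (p : {mpoly A[k]}) d => agreep d p 0)) => // i p d _ p0.
apply: agreepM0 => //; elim: (m i) => // e IHe.
rewrite exprS -add1n; apply: agreepM0 => // m1.
by rewrite ltnS leqn0 mdeg_eq0 => /eqP ->; rewrite /fps_of_mpoly g0 mcoeff0.
Qed.

(** Continuity of composition: sums and products respect the congruence, so [g] may be replaced by
    [h] under [p]; then [p] is replaced by [q]. *)
Lemma agreep_comp d p q g h :
    agreep d p q -> (forall i, agreep d (tnth g i) (tnth h i)) ->
    (forall i, (tnth h i)@_0 = 0) ->
  agreep d (p \mPo g) (q \mPo h).
Proof.
move=> pq gh h0; apply: (@agree_trans _ _ _ _ (fps_of_mpoly (p \mPo h))).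
  rewrite !comp_mpolyE; apply: agreep_sum => m; apply: agreepZ.
  by apply: agreep_prod => i; apply: agreepX.
(* All monomials of [p - q] have degree at least [d], and by [prod_order] substituting [h] does not
   lower their order. *)
apply/agreepB0; rewrite -comp_mpolyB comp_mpolyE => m m_d.
rewrite /fps_of_mpoly mcoeff0 raddf_sum big1 //= => m1 _; rewrite mcoeffZ.
have [m1d|m1d] := ltnP (mdeg m1) d.
  have /agreepB0/(_ _ m1d) := pq.
  by rewrite /fps_of_mpoly mcoeff0 => ->; rewrite mul0r.
have := prod_order (m:=m1) h0 (leq_trans m_d m1d).
by rewrite /fps_of_mpoly mcoeff0 => ->; rewrite mulr0.
Qed.

(** Additivity reduces to monomials and the Leibniz rule to variables. The derivation is kept
    abstract, killing just the coefficients of [p], so that it can be a z-derivative as well as the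
    t-derivative when [p] is free of t. *)
Lemma chain_rule (D : {additive {mpoly A[k]} -> {mpoly A[k]}}) p g :
    (forall u v, D (u * v) = D u * v + u * D v) ->
    (forall m, D (p@_m)%:MP = 0) ->
  D (p \mPo g) = \sum_(j < n) (p^`M(j) \mPo g) * D (tnth g j).
Proof.
move=> DM Dp.
have D1 : D 1 = 0.
  have /eqP := DM 1 1.
  by rewrite !mul1r mulr1 -subr_eq subrr => /eqP.
have DXU i : D ('X_i \mPo g) = \sum_(j < n) ('X_i^`M(j) \mPo g) * D (tnth g j).
  rewrite comp_mpolyXU -tnth_nth (bigD1 i) //= big1 => [|j ji].
    by rewrite mderivX mnm1E eqxx scale1r subUU mpolyX0 comp_mpoly1
               mul1r addr0.
  by rewrite mderivX mnm1E eq_sym (negbTE ji) scale0r comp_mpoly0 mul0r.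
have DMn u v :
    D (u \mPo g) = \sum_(j < n) (u^`M(j) \mPo g) * D (tnth g j) ->
    D (v \mPo g) = \sum_(j < n) (v^`M(j) \mPo g) * D (tnth g j) ->
  D ((u * v) \mPo g) = \sum_(j < n) ((u * v)^`M(j) \mPo g) * D (tnth g j).
  move=> Du Dv; rewrite rmorphM /= DM Du Dv mulr_suml mulr_sumr -big_split /=.
  by apply: eq_bigr => j _; rewrite mderivM comp_mpolyD !rmorphM /=; ring.
have DX m :
    D ('X_[m] \mPo g) = \sum_(j < n) ('X_[m]^`M(j) \mPo g) * D (tnth g j).
  rewrite mpolyXE_id; elim/big_rec: _ => [|i u _ IHu]; last first.
    apply/DMn => //; elim: (m i) => [|e IHe]; last by rewrite exprS; apply/DMn.
    rewrite expr0 comp_mpoly1 D1 big1 // => j _.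
    by rewrite mderivC comp_mpoly0 mul0r.
  by rewrite comp_mpoly1 D1 big1 // => j _; rewrite mderivC comp_mpoly0 mul0r.
have -> : D (p \mPo g) = \sum_(m <- msupp p) (p@_m)%:MP * D ('X_[m] \mPo g).
  rewrite comp_mpolyEX raddf_sum; apply: eq_bigr => m _.
  by rewrite -mul_mpolyC DM Dp mul0r add0r.
have pE j : p^`M(j) \mPo g =
    \sum_(m <- msupp p) (p@_m)%:MP * ('X_[m]^`M(j) \mPo g).
  rewrite {1}[p]mpolyE (raddf_sum (mderiv j)) (raddf_sum (comp_mpoly g)) /=.
  by apply: eq_bigr => m _; rewrite mderivZ comp_mpolyZ mul_mpolyC.
under [RHS]eq_bigr => j _ do rewrite pE mulr_suml.
rewrite exchange_big /=; apply: eq_bigr => m _.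
by rewrite DX mulr_sumr; apply: eq_bigr => j _; rewrite mulrA.
Qed.

End Composition.

(** * Passing from series to polynomial representatives *)

Section Series.
Context (n : nat) (A : comNzRingType).
Implicit Types (f : fps n A) (p q : {mpoly A[n]}).

Lemma mcoeff_trunc d f m :
  (fps_trunc d f)@_m = if (mdeg m < d)%N then f m else 0.
Proof.
have -> : fps_trunc d f =
    \sum_(k : 'X_{1..n < d}) (fun m => f m) k *: 'X_[k] by [].
have [m_d|m_d] := ltnP; first exact: mcoeff_mpoly.
rewrite raddf_sum big1 //= => k _; rewrite mcoeffZ mcoeffX.
case: eqP => [k_m|_]; last by rewrite mulr0.
by move: m_d; rewrite -k_m leqNgt bmdeg.
Qed.

Lemma agree_trunc d f : agree d f (fps_of_mpoly (fps_trunc d f)).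
Proof. by move=> m m_d; rewrite /fps_of_mpoly mcoeff_trunc m_d. Qed.

Lemma agree_comp d f (G : 'I_n -> fps n A) p (g : n.-tuple {mpoly A[n]}) :
    agree d f (fps_of_mpoly p) ->
    (forall i, agree d (G i) (fps_of_mpoly (tnth g i))) ->
    (forall i, (tnth g i)@_0 = 0) ->
  agree d (fps_comp f G) (fps_of_mpoly (p \mPo g)).
Proof.
move=> fp Gg g0 m m_d; rewrite /fps_comp /=.
(* The coefficient of z^m in [fps_comp] is computed from truncations at |m| + 1, which is at most
   [d]. *)
apply: (@agreep_comp _ _ _ (mdeg m).+1) => // [k|i k] k_m.
  by rewrite -agree_trunc // fp // (leq_trans k_m).
by rewrite tnth_mktuple -agree_trunc // Gg // (leq_trans k_m).
Qed.

Lemma fps_compZ a f (G : 'I_n -> fps n A) m :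
  fps_comp (a \*o f) G m = a * fps_comp f G m.
Proof.
rewrite /fps_comp -mcoeffZ -comp_mpolyZ; congr (_ \mPo _)@_m.
by rewrite /fps_trunc scaler_sumr; apply: eq_bigr => k _; rewrite scalerA.
Qed.

Lemma fps_compB f f' (G : 'I_n -> fps n A) m :
  fps_comp (f \- f') G m = fps_comp f G m - fps_comp f' G m.
Proof.
rewrite /fps_comp -mcoeffB -comp_mpolyB; congr (_ \mPo _)@_m.
by rewrite /fps_trunc -sumrB; apply: eq_bigr => k _; rewrite scalerBl.
Qed.

(** If z_i divides z^m, the coefficient at m, multiplied by the exponent of z_i, is a coefficient of
    the i-th derivative one degree lower. Torsion-freeness cancels the exponent, and one degree of
    precision is gained. *)
Lemma agreep_integral d p q :
    (forall (a : A) k, a *+ k.+1 = 0 -> a = 0) -> p@_0 = q@_0 ->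
    (forall i, agreep d p^`M(i) q^`M(i)) ->
  agreep d.+1 p q.
Proof.
move=> A0 pq0 pq m m_d; rewrite /fps_of_mpoly.
have [->//|m0] := eqVneq m 0%MM.
have [i mi] : exists i, m i != 0%N.
  apply/existsP; apply: contraNT m0; rewrite negb_exists => /forallP m0.
  by apply/eqP/mnmP => i; rewrite mnm0E; apply/eqP; rewrite -[_ == _]negbK m0.
have mE : (m - U_(i) + U_(i))%MM = m by rewrite submK // lep1mP.
have := pq i (m - U_(i))%MM; rewrite /fps_of_mpoly !mcoeff_mderiv mE.
rewrite -ltnS -[(mdeg _).+1]addn1 -(mdeg1 i) -mdegD mE => /(_ m_d) /eqP.
by rewrite -subr_eq0 -mulrnBl => /eqP /A0 /eqP; rewrite subr_eq0 => /eqP.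
Qed.

Lemma agree_euler d f p :
    agree d.+1 f (fps_of_mpoly p) ->
  agree d (euler f) (fps_of_mpoly (\sum_(i < n) 'X_i * p^`M(i))).
Proof.
move=> fp m m_d; rewrite /euler /fps_of_mpoly raddf_sum /=.
apply: eq_bigr => i _; rewrite mcoeffM; apply: eq_bigr => -[k1 k2] /= /eqP mE.
congr (_ * _); rewrite mcoeff_mderiv /fps_deriv fp //.
rewrite mdegD mdeg1 addn1 ltnS (leq_ltn_trans _ m_d) //.
by rewrite [X in (_ <= mdeg X)%N]mE mdegD leq_addl.
Qed.

Lemma order_ge0 f d m :
  order_ge d f -> (mdeg m < d)%N -> f m = 0.
Proof.
move=> ord_f m_d; apply/eqP; apply: contraLR m_d => /ord_f.
by rewrite -leqNgt.
Qed.

Lemma agree_fps_deriv d f p i :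
    agree d.+1 f (fps_of_mpoly p) ->
  agree d (fps_deriv i f) (fps_of_mpoly p^`M(i)).
Proof.
move=> fp m m_d; rewrite /fps_deriv /fps_of_mpoly mcoeff_mderiv.
by rewrite fp // mdegD mdeg1 addn1.
Qed.

End Series.

(** * The Hamilton-Jacobi equation for truncations *)

Section HamiltonJacobi.
Context (K : numFieldType) (n : nat).
Implicit Types (p q : {mpoly {poly K}[n]}).

Definition mpoly_dt p : {mpoly {poly K}[n]} := map_mpoly (@deriv K) p.

HB.instance Definition _ := GRing.Additive.copy mpoly_dt (map_mpoly (@deriv K)).

Lemma mcoeff_dt p m : (mpoly_dt p)@_m = (p@_m)^`().
Proof. exact: mcoeff_map_mpoly. Qed.

Lemma mpoly_dtM p q : mpoly_dt (p * q) = mpoly_dt p * q + p * mpoly_dt q.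
Proof.
apply/mpolyP => m; rewrite mcoeffD mcoeff_dt !mcoeffM raddf_sum -big_split /=.
by apply: eq_bigr => k _; rewrite derivM !mcoeff_dt.
Qed.

Lemma mpoly_dtC (c : {poly K}) : mpoly_dt c%:MP = (c^`())%:MP.
Proof. exact: map_mpolyC. Qed.

Lemma mpoly_dtX m : mpoly_dt 'X_[m] = 0.
Proof.
by apply/mpolyP => k; rewrite mcoeff_dt mcoeffX mcoeff0 -polyC_natr derivC.
Qed.

(* The truncation of [Gt]. *)
Definition deformation q : n.-tuple {mpoly {poly K}[n]} :=
  [tuple 'X_i + 'X *: q^`M(i) | i < n].

Definition grad2 q : {mpoly {poly K}[n]} := \sum_(j < n) q^`M(j) ^+ 2.

(** The closed form q + (t/2) |grad q|^2 that P(G) will turn out to have. *)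
Definition potential q := q + (2^-1 *: 'X : {poly K}) *: grad2 q.

Lemma poly_torsion_free (a : {poly K}) k : a *+ k.+1 = 0 -> a = 0.
Proof.
move=> ak; apply/polyP => i; have := congr1 (coefp i) ak.
by rewrite /= coefMn coef0 => /eqP; rewrite mulrn_eq0 => /eqP.
Qed.

Lemma two_half : 2 * (2^-1)%:P = 1 :> {poly K}.
Proof. by rewrite -polyC_natr -polyCM divff ?pnatr_eq0. Qed.

Lemma half_tM2 : (2^-1 *: 'X : {poly K}) *+ 2 = 'X.
Proof. by rewrite -scaler_nat scalerA divff ?scale1r // pnatr_eq0. Qed.

Lemma mderiv_sqr p i : (p ^+ 2)^`M(i) = (p * p^`M(i)) *+ 2.
Proof. by rewrite expr2 mderivM [_ * p]mulrC. Qed.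

(** Since d_i G_j = delta_ij + t d_i d_j q, the right side is d_i q plus t times half of d_i |grad
    q|^2. *)
Lemma deriv_potential q i :
  (potential q)^`M(i) =
  \sum_(j < n) q^`M(j) * (tnth (deformation q) j)^`M(i).
Proof.
rewrite /potential mderivD mderivZ.
have -> : (grad2 q)^`M(i) = (\sum_(j < n) q^`M(j) * q^`M(j)^`M(i)) *+ 2.
  rewrite /grad2 (raddf_sum (mderiv i)) -sumrMnl.
  by apply: eq_bigr => j _; rewrite [LHS]mderiv_sqr.
rewrite -scaler_nat scalerA mulr_natr half_tM2 scaler_sumr.
under [RHS]eq_bigr => j _ do
  rewrite tnth_mktuple mderivD mderivZ mulrDr -scalerAr.
rewrite big_split; congr (_ + _).
rewrite (bigD1 i) // big1 => [|j ji]; last first.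
  by rewrite mderivX mnm1E (negbTE ji) scale0r mulr0.
by rewrite [RHS]addr0 mderivX mnm1E eqxx scale1r subUU mpolyX0 mulr1.
Qed.

(** With T as below, the t-derivative of the potential is dq/dt + 1/2 |grad q|^2 + t T, whereas the
    sum on the right is |grad q|^2 + t T; the extra half is added on the left. *)
Lemma dt_potential q :
  mpoly_dt (potential q) + 2^-1%:P *: grad2 q = mpoly_dt q +
  \sum_(j < n) q^`M(j) * mpoly_dt (tnth (deformation q) j).
Proof.
pose T := \sum_(j < n) q^`M(j) * mpoly_dt q^`M(j).
have -> : \sum_(j < n) q^`M(j) * mpoly_dt (tnth (deformation q) j) =
    grad2 q + 'X *: T.
  rewrite scaler_sumr -big_split /=; apply: eq_bigr => j _.
  rewrite tnth_mktuple raddfD /= -[_ *: _]mul_mpolyC mpoly_dtM !mpoly_dtC.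
  by rewrite derivX mpoly_dtX add0r mul1r mulrDr -expr2 mul_mpolyC scalerAr.
have dt_grad2 : mpoly_dt (grad2 q) = T *+ 2.
  rewrite /grad2 raddf_sum -sumrMnl; apply: eq_bigr => j _.
  by rewrite [LHS]mpoly_dtM mulrC.
rewrite raddfD /= -{1}[_ *: grad2 q]mul_mpolyC mpoly_dtM mpoly_dtC.
rewrite derivZ derivX dt_grad2 !mul_mpolyC alg_polyC.
rewrite -[T *+ 2]scaler_nat scalerA mulr_natr half_tM2.
rewrite -!addrA; congr (_ + _); rewrite [X in _ + X]addrC addrA -scalerDl.
by rewrite -polyCD -mulr2n -[_ *+ 2]mulr_natr mulVf ?pnatr_eq0 ?scale1r.
Qed.

Lemma hamilton_jacobi d p q :
    (forall m, (p@_m)^`() = 0) -> p@_0 = 0 ->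
    q@_0 = 0 -> (forall i, q@_U_(i) = 0) ->
    (forall i, agreep d q^`M(i) (p^`M(i) \mPo deformation q)) ->
  agreep d.+1 (p \mPo deformation q) (potential q) /\
  agreep d (2^-1%:P *: grad2 q) (mpoly_dt q).
Proof.
move=> dt_p p0 q0 q1 qp; set g := deformation q.
have qi0 i : q^`M(i)@_0 = 0 by rewrite mcoeff_mderiv add0m q1 mul0rn.
have g0 i : (tnth g i)@_0 = 0.
  rewrite tnth_mktuple mcoeffD mcoeffZ qi0 mulr0 addr0 mcoeffX.
  by rewrite -mdeg_eq0 mdeg1.
(* The chain rule with (grad p)(G) replaced by grad q, for any derivation D that kills the
   coefficients of [p]. *)
have chain (D : {additive {mpoly {poly K}[n]} -> {mpoly {poly K}[n]}}) :
    (forall u v, D (u * v) = D u * v + u * D v) ->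
    (forall m, D (p@_m)%:MP = 0) ->
  agreep d (D (p \mPo g)) (\sum_(j < n) q^`M(j) * D (tnth g j)).
  move=> DM Dp; rewrite chain_rule //; apply: agreep_sum => j.
  by apply: agreepM => //; apply: agree_sym.
have U_pot : agreep d.+1 (p \mPo g) (potential q).
  apply: agreep_integral; first exact: poly_torsion_free.
    have -> : (potential q)@_0 = 0.
      rewrite mcoeffD q0 add0r mcoeffZ raddf_sum big1 ?mulr0 //= => j _.
      by rewrite rmorphXn /= qi0 expr0n.
    (* Continuity with d = 1: [p] agrees with 0 in degree 0, hence so does the composite. *)
    have := @agreep_comp n n _ 1 p 0 g g _ _ g0 0%MM.
    rewrite mdeg0 comp_mpoly0 /fps_of_mpoly mcoeff0; apply=> // m.
    by rewrite ltnS leqn0 mdeg_eq0 => /eqP ->; rewrite /fps_of_mpoly p0 mcoeff0.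
  move=> i; rewrite deriv_potential; apply: (chain (mderiv i)) => [u v|m].
    exact: mderivM.
  exact: mderivC.
split=> //; set S := _ *: _.
have dt_pot : mpoly_dt (potential q) + S = _ := dt_potential q.
have dt_u : agreep d (mpoly_dt (p \mPo g)) (mpoly_dt (potential q)).
  move=> m m_d; rewrite /fps_of_mpoly [LHS]mcoeff_dt [RHS]mcoeff_dt.
  by congr (_^`()); apply: U_pot; apply: ltnW.
have dt_uE : agreep d (mpoly_dt (p \mPo g))
    (\sum_(j < n) q^`M(j) * mpoly_dt (tnth g j)).
  apply: (chain mpoly_dt) => [u v|m]; first exact: mpoly_dtM.
  by rewrite [LHS]mpoly_dtC dt_p.
(* Below degree [d] the t-derivative of the potential equals the sum in [dt_pot], so the two cancel
   and leave S = dq/dt. *)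
move=> m m_d; have := congr1 (mcoeff m) dt_pot; rewrite !mcoeffD.
have := dt_uE m m_d; have := dt_u m m_d; rewrite /fps_of_mpoly => -> ->.
by rewrite addrC => /addIr.
Qed.

End HamiltonJacobi.

(** * The formulas for U and W below a given degree *)

Section DeformedPair.
Context (R : realType) (n : nat) (P : fps n R[i]) (Q : fps n {poly R[i]}).
Context (ordP : order_ge 2 P) (PQ : deformed_inversion_pair P Q) (d : nat).

(** Degree [d] itself is kept, because a first derivative costs one degree. *)
Let p := fps_trunc d.+1 (const_t P).
Let q := fps_trunc d.+1 Q.

Lemma trunc_coef m : (mdeg m < d)%N -> q@_m = Q m.
Proof. by move=> m_d; rewrite mcoeff_trunc ltnW. Qed.

Lemma trunc_coef01 : q@_0 = 0 /\ forall i, q@_U_(i) = 0.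
Proof.
have [ordQ _] := PQ.
split=> [|i]; rewrite mcoeff_trunc (order_ge0 ordQ) ?mdeg0 ?mdeg1 //.
by case: ifP.
Qed.

Lemma deformation0 i : (tnth (deformation q) i)@_0 = 0.
Proof.
have [_ q1] := trunc_coef01.
rewrite tnth_mktuple mcoeffD mcoeffZ mcoeff_mderiv add0m q1 mul0rn mulr0 addr0.
by rewrite mcoeffX -mdeg_eq0 mdeg1.
Qed.

Lemma agree_Gt i : agree d (Gt Q i) (fps_of_mpoly (tnth (deformation q) i)).
Proof.
move=> m m_d; rewrite /Gt /= (agree_fps_deriv i (@agree_trunc _ _ d.+1 Q)) //.
by rewrite tnth_mktuple /zvar /fps_of_mpoly mcoeffD mcoeffZ.
Qed.

(** The identity F(G) = z reads z_i + t d_i Q - t (d_i P)(G) = z_i, and t is not a zero divisor in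
    C[t]. *)
Lemma trunc_gradient i :
  agreep d q^`M(i) (p^`M(i) \mPo deformation q).
Proof.
have [_ [FG _]] := PQ.
have Fp : agree d (Ft P i) (fps_of_mpoly ('X_i - 'X *: p^`M(i))).
  move=> m m_d.
  have pE := agree_fps_deriv i (@agree_trunc _ _ d.+1 (const_t P)).
  by rewrite /Ft /= pE // /zvar /fps_of_mpoly mcoeffB mcoeffZ.
move=> m m_d; have := agree_comp Fp agree_Gt deformation0 m_d.
rewrite FG /zvar /fps_of_mpoly comp_mpolyB comp_mpolyZ comp_mpolyXU.
rewrite -tnth_nth tnth_mktuple !(mcoeffB, mcoeffD, mcoeffZ) -addrA.
move=> /esym/(canRL (addKr _)).
rewrite addNr -mulrBr => /eqP; rewrite mulf_eq0 polyX_eq0 /=.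
by rewrite subr_eq0 => /eqP.
Qed.

Lemma trunc_hamilton_jacobi :
  agreep d.+1 (p \mPo deformation q) (potential q) /\
  agreep d (2^-1%:P *: grad2 q) (mpoly_dt q).
Proof.
have [q0 q1] := trunc_coef01; apply: hamilton_jacobi => // [m||].
- by rewrite mcoeff_trunc; case: ifP; rewrite ?derivC ?deriv0.
- by rewrite mcoeff_trunc mdeg0 /const_t (order_ge0 ordP) ?mdeg0.
- exact: trunc_gradient.
Qed.

Lemma agree_Ut : agree d (Ut P Q) (Q \+ 'X \*o dt Q).
Proof.
have [U S] := trunc_hamilton_jacobi.
move=> m m_d; rewrite /Ut.
rewrite (agree_comp _ agree_Gt deformation0 m_d (p := p)); last first.
  exact/(agree_le (leqnSn d))/agree_trunc.
rewrite U ?ltnS 1?ltnW // /fps_of_mpoly mcoeffD mcoeffZ.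
have := S m m_d; rewrite /fps_of_mpoly mcoeffZ mcoeff_dt.
rewrite -mul_polyC mulrAC mulrC => ->.
by rewrite trunc_coef // mulrC.
Qed.

Lemma agree_Wt :
  agree d (Wt Q) (sigma2 \+ (2 * 'X) \*o euler Q \+ (2 * 'X ^+ 2) \*o dt Q).
Proof.
have [_ S] := trunc_hamilton_jacobi.
move=> m m_d; rewrite /Wt.
(* [sigma2] is already a polynomial and represents itself. *)
rewrite (agree_comp (fun _ _ => erefl) agree_Gt deformation0 m_d).
have -> : (\sum_(i < n) 'X_i ^+ 2 : {mpoly {poly R[i]}[n]}) \mPo deformation q =
    \sum_(i < n) 'X_i ^+ 2
    + (2 * 'X : {poly R[i]}) *: (\sum_(i < n) 'X_i * q^`M(i))
    + ('X ^+ 2 : {poly R[i]}) *: grad2 q.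
  rewrite raddf_sum /= !scaler_sumr -!big_split /=; apply: eq_bigr => i _.
  rewrite rmorphXn /= comp_mpolyXU -tnth_nth tnth_mktuple sqrrD.
  congr (_ + _ + _).
    by rewrite -scalerAr -mulr_natl -scalerA scaler_nat mulr_natl.
  by rewrite exprZn.
rewrite /fps_of_mpoly !mcoeffD ![in LHS]mcoeffZ /=.
congr (_ + _ + _).
  by rewrite (agree_euler (@agree_trunc _ _ d.+1 Q) m_d).
(* The remaining term t^2 |grad Q|^2 becomes 2 t^2 dQ/dt by the Hamilton-Jacobi equation. *)
have := S m m_d; rewrite /fps_of_mpoly mcoeffZ mcoeff_dt trunc_coef //.
rewrite /dt => <-.
by rewrite mulrACA two_half mul1r.
Qed.

End DeformedPair.

(** * The exact formulas, coefficient by coefficient *)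

Theorem proposition7p2 (R : realType) (n : nat) (P : fps n R[i])
    (ordP : order_ge 2 P) (nilP : nilpotent_mx (Hes0 P))
    (Q : fps n {poly R[i]}) (PQ : deformed_inversion_pair P Q) :
  [/\ Ut P Q =1 Q \+ 'X \*o dt Q,
      Vt P Q =1 (2^-1)%:P \*o sigma2 \+ 'X \*o (euler Q \- Q)
    & Wt Q =1 sigma2 \+ (2 * 'X) \*o euler Q \+ (2 * 'X ^+ 2) \*o dt Q].
Proof.
have UE : Ut P Q =1 Q \+ 'X \*o dt Q.
  (* Precision |m| + 1 suffices for the coefficient of z^m. *)
  by move=> m; apply: (agree_Ut ordP PQ (ltnSn (mdeg m))).
have WE : Wt Q =1 sigma2 \+ (2 * 'X) \*o euler Q \+ (2 * 'X ^+ 2) \*o dt Q.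
  by move=> m; apply: (agree_Wt ordP PQ (ltnSn (mdeg m))).
split; [exact: UE | move=> m | exact: WE].
have -> : Vt P Q m = (2^-1)%:P * Wt Q m - 'X * Ut P Q m.
  by rewrite /Vt /ft fps_compB !fps_compZ.
have two_h : 2 * (2^-1)%:P = 1 :> {poly R[i]} := two_half _.
(* Abstracting 1/2 to [h] with 2h = 1 leaves an identity in a commutative ring. *)
rewrite UE WE /=; move: (2^-1)%:P two_h 'X => h two_h t.
have -> : h * (sigma2 m + 2 * t * euler Q m + 2 * t ^+ 2 * dt Q m) =
    h * sigma2 m + (2 * h) * (t * euler Q m + t ^+ 2 * dt Q m) by ring.
by rewrite two_h; ring.
Qed.
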